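(* Let $P_d$ be a discrete path with $K$ path points, let $C$ be a lattice planner control set, let $O$ be the origin of the lattice (the common starting point of $P_d$ and of all lattice paths considered), and let $B$ be the greedy upper bound on the optimal score described in the context. Let $\Delta x,\Delta y$ be the lattice resolutions, put $A=\Delta x\,\Delta y$, and let $N$ be the maximum number of path points across all control actions in $C$. Then the algorithm ClosestPath$(P_d,C,O,B)$ (given in the context) is correct, that is, it finds a path $P_l$ in the lattice graph constructed from $C$, starting at $O$, with minimum score $d(P_d,P_l)$ to $P_d$; and it has runtime $$O\!\left(N\,\frac{B^{2}}{A}\,K\,|C|\right).$$
   Context: Lattice. Lattice points are triples $(x,y,\theta)$ in a subset of $\mathrm{SE}(2)$, discretized with resolutions $\Delta x$ and $\Delta y$ in $x$ and $y$ and with a finite heading set $\Theta$. A control set $C$ consists of control actions; each heading $\bar\theta\in\Theta$ has an associated subset $C_{\bar\theta}\subseteq C$, with $\sum_{\bar\theta\in\Theta}|C_{\bar\theta}|=|C|$. The actions in $C_{\bar\theta}$ can be applied at any lattice point $(x,y,\bar\theta)$, and applying one leads to a lattice point $(x',y',\theta')$ whose relative position $(x'-x,y'-y,\theta'-\bar\theta)$ is fixed for that action. Lattice points are the vertices and these transitions are the edges of the lattice graph. Each control action has an underlying path, and a lattice path $P_l$ is a concatenation of control actions in the lattice graph. Discretization and score. All paths are sampled with respect to arc length in segments of equal length $\delta$. $P_d$ has the $K$ points $P_d(0),\dots,P_d(K-1)$, the $0$-th being the origin. For a lattice path $P_l$ starting at $O$ and at least as long as $P_d$, $$d(P_d,P_l)=\max_{k\in\{0,\dots,K-1\}}\|P_d(k)-P_l(k)\|.$$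 For a control action $c$ applied at a lattice vertex reached at path point $k_1$ and ending at path point $k_2$ (so that $c$ has $k_2-k_1$ segments, with sampled points $c(0),\dots,c(k_2-k_1)$ placed where the action is applied), $$d(P_d,c,k_1,k_2)=\max_{k\in\{k_1,\dots,k_2\}}\|P_d(k)-c(k-k_1)\|.$$ The comparison is made only along the arc length of $P_d$ and no further: a lattice path may be longer than $P_d$ and is then truncated to the arc length of $P_d$. Bound $B$. $B$ is an upper bound on the optimal score, obtained by greedily selecting control actions, each minimizing $d$ over the corresponding section of $P_d$. In the runtime, $B$ is this input value. Algorithm ClosestPath$(P_d,C,O,B)$. Lattice vertices are distinguished by the number of path points used to reach them; $V[k]$ holds the lattice vertices reached with $k$ path points. The function applyControlAction$(u,c,i)$ takes a lattice vertex $u$, a control action $c$ and the path point $i$ of $u$, and returns the successor lattice vertex $v$ and the resulting path point $j$. An empty entry of the table costs means infinite cost. 1. bestEnd $\gets O$; costs and predecessors are empty hash tables; $K=\text{length}(P_d)$; $V$ is an array of $K$ hash tables; $V[0][O]=O$; $\text{costs}[O,0]=0$. 2. For all $i\in\{0,\dots,K-1\}$, for all $u\in V[i]$, for all $c\in C_{\theta}$ where $\theta$ is the heading of $u$: (a) $(v,j)\gets\text{applyControlAction}(u,c,i)$ and $d_{u,v}\gets d(P_d,c,i,j)$; (b) if $d_{u,v}>B$, continue with the next control action; (c) $V[j][v]=v$; (d) if $\max(\text{costs}[u,i],d_{u,v})<\text{costs}[v,j]$, then $\text{predecessors}[v]\gets u$ and $\text{costs}[v,j]\gets\max(\text{costs}[u,i],d_{u,v})$;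 (e) if $\text{costs}[v,j]<B$ and $j\ge K$, then bestEnd $\gets v$ and $B\gets\text{costs}[v,j]$. 3. Return (bestEnd, predecessors).
   Formalization: If bestEnd is never updated (greedy path already optimal), the path found is the greedy path; the runtime bound assumes B ≥ εΔx and B ≥ εΔy, constant depending on ε (it fails at B = 0); every heading has a nonempty set of control actions, each with at least one segment. *)

(* Defs.v *)
(* Mathematical Components with MathComp-Analysis. *)
From HB Require Import structures.
From mathcomp Require Import all_boot all_order all_algebra.
From mathcomp Require Import finmap reals constructive_ereal ereal trigo.

Set Implicit Arguments.
Unset Strict Implicit.
Unset Printing Implicit Defensive.

Import Order.TTheory GRing.Theory Num.Theory.

Local Open Scope ring_scope.

Definition edist (R : realType) (p q : R * R) : R :=
  Num.sqrt ((p.1 - q.1) ^+ 2 + (p.2 - q.2) ^+ 2).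

(* Control actions are translated, never rotated, to where they are applied:
   [disp c] and [samples c] are in the axes of the lattice.  [samples c] lists
   the points of the path of [c] relative to its starting point, sampled at a
   common arc-length step; nothing below depends on the value of this step.
   [target t c] is only meaningful when [c \in ctl t]; it is then forced by
   [turn c], as [angle] is injective with values in [0, 2 pi). *)
Record lattice_planner (R : realType) := LatticePlanner {
  resx : R;
  resy : R;
  resx_gt0 : 0 < resx;
  resy_gt0 : 0 < resy;
  heading : finType;
  angle : heading -> R;
  angle_range : forall t, 0 <= angle t < 2 * pi;
  angle_inj : injective angle;
  action : finType;
  ctl : heading -> {set action};
  ctl_card : (\sum_t #|ctl t| = #|action|)%N;
  ctl_neq0 : forall t, ctl t != set0;
  disp : action -> int * int;
  turn : action -> R;
  target : heading -> action -> heading;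
  targetP : forall t c, c \in ctl t ->
    exists k : int, angle (target t c) = angle t + turn c + k%:~R * (2 * pi);
  samples : action -> seq (R * R);
  samples_gt1 : forall c, (1 < size (samples c))%N;
  samples_first : forall c, nth 0 (samples c) 0 = 0;
  samples_last : forall c, nth 0 (samples c) (size (samples c)).-1 =
    (resx * (disp c).1%:~R, resy * (disp c).2%:~R)
}.

(* [((a, b), t)] is the point (a * resx, b * resy, angle t) of SE(2). *)
Definition lpoint (R : realType) (L : lattice_planner R) : Type :=
  (int * int * heading L)%type.
HB.instance Definition _ (R : realType) (L : lattice_planner R) :=
  Choice.on (lpoint L).

(* Lattice vertices are distinguished by the number of path points used to
   reach them. *)
Definition vertex (R : realType) (L : lattice_planner R) : Type :=
  (lpoint L * nat)%type.
HB.instance Definition _ (R : realType) (L : lattice_planner R) :=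
  Choice.on (vertex L).

Section Paths.
Context {R : realType} {L : lattice_planner R}.
Implicit Types (u : lpoint L) (c : action L) (cs : seq (action L)).
Implicit Types (Pd : seq (R * R)).

Definition pos u : R * R := (resx L * u.1.1%:~R, resy L * u.1.2%:~R).

Definition nseg c : nat := (size (samples c)).-1.

Definition succ u c : lpoint L :=
  ((u.1.1 + (disp c).1, u.1.2 + (disp c).2), target u.2 c).

Definition applyControlAction u c (i : nat) : vertex L :=
  (succ u c, (i + nseg c)%N).

Definition placed u c (k : nat) : R * R := pos u + nth 0 (samples c) k.

Fixpoint lattice_path u cs : bool :=
  if cs is c :: cs' then (c \in ctl u.2) && lattice_path (succ u c) cs'
  else true.

Definition path_nseg cs : nat := (\sum_(c <- cs) nseg c)%N.

(* Past the end of the path the value is its last point. *)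
Fixpoint path_point u cs (k : nat) : R * R :=
  if cs is c :: cs' then
    if (k <= nseg c)%N then placed u c k
    else path_point (succ u c) cs' (k - nseg c)
  else pos u.

Definition long_enough Pd cs : bool := ((size Pd).-1 <= path_nseg cs)%N.

Definition path_score Pd u cs : R :=
  \big[Num.max/0]_(k < size Pd) edist (nth 0 Pd k) (path_point u cs k).

(* d(P_d, c, i, i + nseg c) for [c] applied at [u], truncated to P_d. *)
Definition action_score Pd u c (i : nat) : R :=
  \big[Num.max/0]_(i <= k < minn (i + nseg c).+1 (size Pd))
    edist (nth 0 Pd k) (placed u c (k - i)).

Fixpoint greedy_from Pd u (i : nat) cs : Prop :=
  if cs is c :: cs' then
    [/\ (i < (size Pd).-1)%N,
        c \in ctl u.2,
        (forall c', c' \in ctl u.2 ->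
           action_score Pd u c i <= action_score Pd u c' i)
      & greedy_from Pd (succ u c) (i + nseg c) cs']
  else ((size Pd).-1 <= i)%N.

Definition greedy_path Pd u cs : Prop := greedy_from Pd u 0 cs.

End Paths.

(* Step-counting computations: the first component is the number of steps. *)
Definition timed (A : Type) : Type := (nat * A)%type.
Definition tret (A : Type) (a : A) : timed A := (0%N, a).
Definition tbind (A B : Type) (m : timed A) (f : A -> timed B) : timed B :=
  ((m.1 + (f m.2).1)%N, (f m.2).2).
Definition tick (A : Type) (n : nat) (a : A) : timed A := (n, a).

Notation "'let*' x := m 'in' k" := (tbind m (fun x => k))
  (at level 200, x pattern, m at level 200, k at level 200).

(* One step per iteration, and one to leave the loop. *)
Fixpoint tfold (S A : Type) (body : S -> A -> timed S) (s : S) (l : seq A) :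
    timed S :=
  if l is x :: l' then
    let* _ := tick 1 tt in let* s' := body s x in tfold body s' l'
  else tick 1 s.

(* [tableV s k] is the table V[k]; its entries for k >= K are never read. *)
Record state (R : realType) (L : lattice_planner R) := State {
  tableV : nat -> {fset lpoint L};
  costs : {fmap vertex L -> \bar R};
  predecessors : {fmap vertex L -> vertex L};
  bestEnd : vertex L;
  bound : \bar R
}.

(* The unspecified order in which hash tables and control sets are scanned;
   it may depend on the whole current state. *)
Record scan_order (R : realType) (L : lattice_planner R) := ScanOrder {
  scanV : state L -> nat -> seq (lpoint L);
  scanC : state L -> vertex L -> seq (action L);
  scanVP : forall s i, perm_eq (scanV s i) (enum_fset (tableV s i));
  scanCP : forall s u, perm_eq (scanC s u) (enum (ctl u.1.2))
}.

(* Unit-cost model: one step for each arithmetic operation or comparison, each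
   distance between two points, each hash-table access and each assignment;
   creating an array of K tables takes K steps. *)
Section ClosestPath.
Context {R : realType} {L : lattice_planner R}.
Variables (Pd : seq (R * R)) (ord : scan_order L).
Implicit Types (s : state L) (u v : lpoint L) (w : vertex L).

Definition cost_of s w : \bar R := odflt +oo%E (costs s).[? w]%fmap.

Definition insertV s v (j : nat) : state L :=
  State (fun k => if k == j then v |` tableV s k else tableV s k)%fset
    (costs s) (predecessors s) (bestEnd s) (bound s).

Definition set_cost s (w p : vertex L) (x : \bar R) : state L :=
  State (tableV s) (costs s).[w <- x]%fmap (predecessors s).[w <- p]%fmap
    (bestEnd s) (bound s).

Definition set_best s w (x : \bar R) : state L :=
  State (tableV s) (costs s) (predecessors s) w x.

Definition eval_score u (c : action L) (i j : nat) : timed R :=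
  tfold (fun m k => tick 2 (Num.max m (edist (nth 0 Pd k) (placed u c (k - i)))))
    0 (index_iota i (minn j.+1 (size Pd))).

Definition relax (i : nat) u s (c : action L) : timed (state L) :=
  let* (v, j) := tick 1 (applyControlAction u c i) in
  let* d := eval_score u c i j in
  let* pruned := tick 1 (bound s < d%:E)%E in
  if pruned then tret s else
  let* s1 := tick 1 (insertV s v j) in
  let* new := tick 2 (maxe (cost_of s1 (u, i)) d%:E) in
  let* old := tick 1 (cost_of s1 (v, j)) in
  let* improves := tick 1 (new < old)%E in
  let* s2 := if improves then tick 2 (set_cost s1 (v, j) (u, i) new)
             else tret s1 in
  let* cur := tick 1 (cost_of s2 (v, j)) in
  let* better := tick 2 ((cur < bound s2)%E && (size Pd <= j)%N) in
  if better then tick 2 (set_best s2 (v, j) cur) else tret s2.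

Definition scan_vertex (i : nat) s u : timed (state L) :=
  tfold (relax i u) s (scanC ord s (u, i)).

Definition scan_layer s (i : nat) : timed (state L) :=
  tfold (scan_vertex i) s (scanV ord s i).

Definition init (O : lpoint L) (B : R) : state L :=
  State (fun k => if k == 0 then [fset O] else fset0)%fset
    [fmap].[(O, 0%N) <- 0%E]%fmap [fmap]%fmap (O, 0%N) B%:E.

Definition closestPath (O : lpoint L) (B : R) :
    timed (vertex L * {fmap vertex L -> vertex L}) :=
  let* s0 := tick (size Pd + 5) (init O B) in
  let* s := tfold scan_layer s0 (iota 0 (size Pd)) in
  tret (bestEnd s, predecessors s).

End ClosestPath.

(* [traced Pd O preds w cs]: following [preds] back from [w] to (O, 0) yields
   the path [cs].  The table records vertices only, so when parallel edges join
   two consecutive vertices, one with the least score is taken. *)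
Inductive traced (R : realType) (L : lattice_planner R) (Pd : seq (R * R))
    (O : lpoint L) (preds : {fmap vertex L -> vertex L}) :
    vertex L -> seq (action L) -> Prop :=
| TracedOrigin : traced Pd O preds (O, 0%N) [::]
| TracedStep (w p : vertex L) (cs : seq (action L)) (c : action L) :
    preds.[? w]%fmap = Some p ->
    traced Pd O preds p cs ->
    c \in ctl p.1.2 ->
    applyControlAction p.1 c p.2 = w ->
    (forall c', c' \in ctl p.1.2 -> applyControlAction p.1 c' p.2 = w ->
       action_score Pd p.1 c p.2 <= action_score Pd p.1 c' p.2) ->
    traced Pd O preds w (rcons cs c).

(* The search starts from the greedy path [gs], whose score is the input bound,
   and records only strict improvements on the bound: when bestEnd still has
   its initial value, the path found is [gs] itself. *)
Definition found_path (R : realType) (L : lattice_planner R)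
    (Pd : seq (R * R)) (O : lpoint L) (gs : seq (action L))
    (out : vertex L * {fmap vertex L -> vertex L}) (cs : seq (action L)) :
    Prop :=
  if out.1 == (O, 0%N) then cs = gs else traced Pd O out.2 out.1 cs.

Definition optimal_path (R : realType) (L : lattice_planner R)
    (Pd : seq (R * R)) (O : lpoint L) (cs : seq (action L)) : Prop :=
  [/\ lattice_path O cs, long_enough Pd cs
    & forall cs', lattice_path O cs' -> long_enough Pd cs' ->
        path_score Pd O cs <= path_score Pd O cs'].

Definition max_points (R : realType) (L : lattice_planner R) : nat :=
  (\max_(c : action L) size (samples c))%N.

(* Main.v *)
(** Every action has at least one segment, so scanning layer [i] only changes
    layers beyond [i] ([evolves]): an edge, once scanned, has been compared with
    the final cost of its source.  Hence at the end every edge from a table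
    entry either scores more than the final bound or has relaxed its target
    ([edge_done]), and following a long enough path edge by edge shows that the
    final bound is at most the score of that path.  Conversely a path traced
    back through the predecessors scores at most the cost of its last vertex.

    For the runtime, a vertex is stored in [V[k]] only if it lies within [B] of
    [P_d(k)], so each heading occurs at most [(2B/dx + 1) (2B/dy + 1)] times
    there; weighting each heading by the number of its actions and summing gives
    the factor [|C|].  The hypotheses [eps * dx <= B] and [eps * dy <= B] absorb
    the [+ 1]s. *)

Require Import Defs.
From mathcomp Require Import all_boot all_order all_algebra.
From mathcomp Require Import finmap reals constructive_ereal ereal trigo.
From mathcomp Require Import zify ring lra.
Import Order.TTheory GRing.Theory Num.Theory.
Local Open Scope ring_scope.

Set Implicit Arguments.
Unset Strict Implicit.
Unset Printing Implicit Defensive.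

(** * Step-counting loops *)

(** One rule for all loops of the search: [E] is a preorder along which every iteration moves, and
    [D x] is what treating [x] achieves. Since [D x] persists along [E], later iterations cannot
    undo it. *)
Lemma tfold_spec (S : Type) (A : eqType) (body : S -> A -> timed S)
    (I : S -> Prop) (E : S -> S -> Prop) (D : A -> S -> Prop) (T : A -> nat)
    (l : seq A) :
  (forall s, E s s) -> (forall s2 s1 s3, E s1 s2 -> E s2 s3 -> E s1 s3) ->
  (forall x s s', D x s -> E s s' -> D x s') ->
  (forall s x, x \in l -> I s ->
     [/\ I (body s x).2, E s (body s x).2, D x (body s x).2
       & ((body s x).1 <= T x)%N]) ->
  forall s, I s ->
    [/\ I (tfold body s l).2, E s (tfold body s l).2,
        {in l, forall x, D x (tfold body s l).2}
      & ((tfold body s l).1 <= 1 + \sum_(x <- l) (1 + T x))%N].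
Proof.
move=> Erefl Etrans Dmono; elim: l => [|x l IHl] body_spec s Is.
  by split=> //=; rewrite big_nil.
have [Ix Ex Dx Tx] := body_spec s x (mem_head x l) Is.
have [|I' E' D' T'] := IHl _ (body s x).2 Ix.
  by move=> t y yl; apply: body_spec; rewrite inE yl orbT.
split=> //=.
- exact: Etrans E'.
- by move=> y /[!inE] /predU1P[->|/D'//]; exact: Dmono E'.
- by rewrite big_cons; lia.
Qed.

(** * Sampled points and scores of lattice paths *)

Section Geometry.
Context {R : realType} {L : lattice_planner R}.
Implicit Types (u v : lpoint L) (c : action L) (cs : seq (action L)).
Implicit Types (Pd : seq (R * R)) (p q : R * R).

Lemma edist_refl p : edist p p = 0.
Proof. by rewrite /edist !subrr expr0n /= addr0 sqrtr0. Qed.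

Lemma edist_ge1 p q : `|p.1 - q.1| <= edist p q.
Proof. by rewrite -sqrtr_sqr ler_wsqrtr // lerDl sqr_ge0. Qed.

Lemma edist_ge2 p q : `|p.2 - q.2| <= edist p q.
Proof. by rewrite -sqrtr_sqr ler_wsqrtr // lerDr sqr_ge0. Qed.

Lemma nseg_gt0 c : (0 < nseg c)%N.
Proof. by rewrite /nseg; case: (samples c) (samples_gt1 c) => [|? []]. Qed.

Lemma placed_first u c : placed u c 0 = pos u.
Proof. by rewrite /placed samples_first addr0. Qed.

Lemma placed_last u c : placed u c (nseg c) = pos (succ u c).
Proof.
rewrite /placed samples_last /pos /=.
by congr (_, _); rewrite /= intrD mulrDr.
Qed.

Lemma path_point0 u cs : path_point u cs 0 = pos u.
Proof. by case: cs => //= c cs; rewrite placed_first. Qed.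

(** The case [k = 0] also holds because the last sample of [c] is the starting point of the rest of
    the path. *)
Lemma path_point_cons u c cs k :
  path_point u (c :: cs) (nseg c + k) = path_point (succ u c) cs k.
Proof.
rewrite /=; case: k => [|k].
  by rewrite addn0 leqnn placed_last path_point0.
by rewrite addnS ltnNge leq_addr /= -addnS addKn.
Qed.

Lemma path_nseg_cons c cs : path_nseg (c :: cs) = (nseg c + path_nseg cs)%N.
Proof. by rewrite /path_nseg big_cons. Qed.

Lemma path_nseg_rcons cs c : path_nseg (rcons cs c) = (path_nseg cs + nseg c)%N.
Proof. by rewrite /path_nseg -cats1 big_cat big_seq1. Qed.

Definition endpoint u cs : lpoint L := foldl (@succ R L) u cs.

Lemma lattice_path_rcons u cs c :
  lattice_path u (rcons cs c) =
    lattice_path u cs && (c \in ctl (endpoint u cs).2).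
Proof.
by elim: cs u => [|c' cs IHcs] u /=; rewrite ?andbT // IHcs andbA.
Qed.

(** The bound on [k] matters: past the end, [path_point] stays at the last point, whereas [placed]
    reads the default sample 0 and returns to the start of [c]. *)
Lemma path_point_rcons u cs c k : (k <= path_nseg cs + nseg c)%N ->
  path_point u (rcons cs c) k =
    if (k <= path_nseg cs)%N then path_point u cs k
    else placed (endpoint u cs) c (k - path_nseg cs).
Proof.
elim: cs u k => [|c' cs IHcs] u k /=.
  rewrite /path_nseg big_nil add0n => kc; rewrite kc subn0.
  by case: k {kc} => //=; rewrite placed_first.
rewrite path_nseg_cons => kc.
case: (leqP k (nseg c')) => [kc'|kc'].
  by rewrite (leq_trans kc') ?leq_addr.
rewrite IHcs; last by lia.
by rewrite leq_subLR subnDA.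
Qed.

Lemma le_action_score Pd u c i k :
  (i <= k <= i + nseg c)%N -> (k < size Pd)%N ->
  edist (nth 0 Pd k) (placed u c (k - i)) <= action_score Pd u c i.
Proof.
move=> /andP[ik kj] kK.
apply: (le_bigmax_seq _ k predT
  (fun k => edist (nth 0 Pd k) (placed u c (k - i)))) => //.
by rewrite mem_index_iota ik leq_min ltnS kj.
Qed.

Lemma action_score_le Pd u c i (x : R) : 0 <= x ->
  (forall k, (i <= k <= i + nseg c)%N -> (k < size Pd)%N ->
     edist (nth 0 Pd k) (placed u c (k - i)) <= x) ->
  action_score Pd u c i <= x.
Proof.
move=> x0 le_x; rewrite /action_score big_seq; apply: bigmax_le => // k.
rewrite mem_index_iota leq_min ltnS => /and3P[ik kj kK].
by apply: le_x; rewrite ?ik.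
Qed.

Lemma path_score_ge0 Pd u cs : 0 <= path_score Pd u cs.
Proof. exact: bigmax_ge_id. Qed.

Lemma le_path_score Pd u cs k : (k < size Pd)%N ->
  edist (nth 0 Pd k) (path_point u cs k) <= path_score Pd u cs.
Proof.
move=> kK; exact: (le_bigmax _ (fun k : 'I_(size Pd) =>
  edist (nth 0 Pd k) (path_point u cs k)) (Ordinal kK)).
Qed.

Lemma greedy_from_path Pd u i cs : greedy_from Pd u i cs ->
  lattice_path u cs /\ ((size Pd).-1 <= i + path_nseg cs)%N.
Proof.
elim: cs u i => [|c cs IHcs] u i /=; first by rewrite /path_nseg big_nil addn0.
by case=> _ -> _ /IHcs[-> H]; split=> //; rewrite path_nseg_cons addnA.
Qed.

End Geometry.

(** * A single relaxation: resulting state and step count *)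

Section Search.
Context {R : realType} {L : lattice_planner R}.
Variables (Pd : seq (R * R)) (ord : scan_order L) (O : lpoint L) (B : R).
Implicit Types (s : state L) (u v : lpoint L) (w p : vertex L) (c : action L).

Lemma cost_of_set_cost s w p x w' :
  cost_of (set_cost s w p x) w' = if w' == w then x else cost_of s w'.
Proof. by rewrite /cost_of /= fnd_set; case: eqP. Qed.

Lemma eval_scoreP u c i :
  (eval_score Pd u c i (i + nseg c)).2 = action_score Pd u c i /\
  ((eval_score Pd u c i (i + nseg c)).1 <= 3 * size (samples c) + 1)%N.
Proof.
rewrite /eval_score; set F := fun k => edist (nth 0 Pd k) (placed u c (k - i)).
(* Each point takes three steps, one for the iteration and two in the body. The condition on [m]
   serves the empty list, whose maximum is 0. *)
have foldE l m : 0 <= m ->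
    tfold (fun m k => tick 2 (Num.max m (F k))) m l =
    ((3 * size l + 1)%N, Num.max m (\big[Num.max/0]_(k <- l) F k)).
  elim: l m => [|k l IHl] m m0; first by rewrite /= big_nil max_l.
  rewrite /= /tbind /=; rewrite IHl; last by rewrite le_max m0.
  by rewrite /= big_cons maxA; congr (_, _); lia.
rewrite foldE //; split; first by rewrite /= max_r //; exact: bigmax_ge_id.
by rewrite /= size_iota; have := nseg_gt0 c; rewrite /nseg; lia.
Qed.

(** The state left by [relax], freed of the step count. Costs are looked up in [s] itself, as
    inserting into the table does not change them. *)
Definition relaxed u i s c : state L :=
  let w := applyControlAction u c i in
  let d := (action_score Pd u c i)%:E in
  let s1 := insertV s w.1 w.2 in
  let new := maxe (cost_of s (u, i)) d in
  let s2 := if (new < cost_of s w)%E then set_cost s1 w (u, i) new else s1 in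
  if (bound s < d)%E then s
  else if ((cost_of s2 w < bound s)%E && (size Pd <= w.2)%N)
  then set_best s2 w (cost_of s2 w) else s2.

(** The constant 15 is the 14 steps outside [eval_score], when both assignments take place, plus the
    step that leaves its loop. *)
Lemma relaxE u i s c :
  (relax Pd i u s c).2 = relaxed u i s c /\
  ((relax Pd i u s c).1 <= 3 * size (samples c) + 15)%N.
Proof.
rewrite /relax /relaxed /tbind /=.
have [-> T] := eval_scoreP u c i.
case: ifP => _ /=; first by split=> //; lia.
rewrite -[cost_of (insertV _ _ _) (u, i)]/(cost_of s (u, i)).
rewrite -[cost_of (insertV _ _ _) (succ u c, _)]/
  (cost_of s (succ u c, (i + nseg c)%N)).
rewrite -[(succ u c, (i + nseg c)%N)]/(applyControlAction u c i).
by case: (maxe _ _ < _)%E => /=; rewrite -/(applyControlAction u c i);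
  case: ifP => _ /=; split=> //; lia.
Qed.

(** * The search invariant and its preservation by relaxation *)

(** [inv_pred] is an inequality so that it survives a decrease of the cost of [p]; the cost of [w]
    itself drops only when its predecessor is replaced. [inv_start] and [inv_best] match the two
    cases of [found_path], and [inv_near] is what the runtime rests on. *)
Record search_invariant s : Prop := Invariant {
  inv_bound : (bound s <= B%:E)%E;
  inv_start : bestEnd s = (O, 0%N) -> bound s = B%:E;
  inv_best : bestEnd s <> (O, 0%N) ->
    (size Pd <= (bestEnd s).2)%N /\ (cost_of s (bestEnd s) <= bound s)%E;
  inv_cost_ge0 : forall w, (0 <= cost_of s w)%E;
  inv_pred : forall w p, (predecessors s).[? w]%fmap = Some p ->
    exists2 c, c \in ctl p.1.2 /\ applyControlAction p.1 c p.2 = w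
      & (maxe (cost_of s p) (action_score Pd p.1 c p.2)%:E <= cost_of s w)%E;
  inv_reached : forall w, (cost_of s w < +oo)%E ->
    w = (O, 0%N) \/ exists p, (predecessors s).[? w]%fmap = Some p;
  inv_table : forall u k, u \in tableV s k -> (cost_of s (u, k) < +oo)%E;
  inv_near : forall u k, u \in tableV s k -> (k < size Pd)%N ->
    edist (nth 0 Pd k) (pos u) <= B;
  inv_origin : O \in tableV s 0;
  inv_origin_cost : (cost_of s (O, 0%N) <= 0)%E
}.

Record evolves (i : nat) s s' : Prop := Evolves {
  ev_bound : (bound s' <= bound s)%E;
  ev_table : forall k u, u \in tableV s k -> u \in tableV s' k;
  ev_cost : forall w, (cost_of s' w <= cost_of s w)%E;
  ev_table_frozen : forall k, (k <= i)%N -> tableV s' k = tableV s k;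
  ev_cost_frozen : forall w, (w.2 <= i)%N -> cost_of s' w = cost_of s w
}.

Lemma evolves_refl i s : evolves i s s.
Proof. by []. Qed.

Lemma evolves_trans i s2 s1 s3 :
  evolves i s1 s2 -> evolves i s2 s3 -> evolves i s1 s3.
Proof.
move=> [b t c ft fc] [b' t' c' ft' fc']; split.
- exact: le_trans b.
- by move=> k u /t /t'.
- by move=> w; exact: le_trans (c w).
- by move=> k ki; rewrite ft' ?ft.
- by move=> w wi; rewrite fc' ?fc.
Qed.

Lemma evolvesW i i' s s' : (i' <= i)%N -> evolves i s s' -> evolves i' s s'.
Proof.
move=> ii' [b t c ft fc]; split=> //.
- by move=> k ki; apply: ft; exact: leq_trans ii'.
- by move=> w wi; apply: fc; exact: leq_trans ii'.
Qed.

Definition edge_done u i c s : Prop :=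
  let w := applyControlAction u c i in
  let d := (action_score Pd u c i)%:E in
  (bound s < d)%E \/
  [/\ w.1 \in tableV s w.2, (cost_of s w <= maxe (cost_of s (u, i)) d)%E
    & (size Pd <= w.2)%N -> (bound s <= maxe (cost_of s (u, i)) d)%E].

(** The cost of the source is in a frozen layer, while the bound and the cost of the target can only
    decrease, so either alternative persists. *)
Lemma edge_done_evolves u i c s s' :
  edge_done u i c s -> evolves i s s' -> edge_done u i c s'.
Proof.
rewrite /edge_done => D [b t co _ fc]; rewrite (fc (u, i)) //.
case: D => [D|[D1 D2 D3]]; [left|right].
  exact: le_lt_trans D.
split; [exact: t|exact: le_trans D2|move=> /D3; exact: le_trans].
Qed.

(** The minimum treats the improving and the non-improving case of an unpruned edge at once. *)
Definition successor_cost u i s c : \bar R :=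
  mine (cost_of s (applyControlAction u c i))
       (maxe (cost_of s (u, i)) (action_score Pd u c i)%:E).

Lemma cost_of_relaxed u i s c w : ~ (bound s < (action_score Pd u c i)%:E)%E ->
  cost_of (relaxed u i s c) w =
    if w == applyControlAction u c i then successor_cost u i s c
    else cost_of s w.
Proof.
move=> /negP/negbTE pr; rewrite /relaxed pr /successor_cost.
set w0 := applyControlAction u c i; set new := maxe _ _.
have costE s2 x : cost_of (set_best s2 w0 x) w = cost_of s2 w by [].
rewrite (fun_if (fun s => cost_of s w)) costE if_same.
case: ifP => nw; first rewrite cost_of_set_cost.
  by case: eqP => // _; rewrite min_r // ltW.
rewrite -[cost_of _ _]/(cost_of s w); case: eqP => // ->.
by rewrite min_l // leNgt nw.
Qed.

Lemma tableV_relaxed u i s c k : ~ (bound s < (action_score Pd u c i)%:E)%E ->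
  tableV (relaxed u i s c) k =
    if k == (i + nseg c)%N then (succ u c |` tableV s k)%fset else tableV s k.
Proof.
move=> /negP/negbTE pr; rewrite /relaxed pr /=.
by case: (maxe _ _ < _)%E => /=; case: (_ && _).
Qed.

Lemma predecessors_relaxed u i s c w :
  ~ (bound s < (action_score Pd u c i)%:E)%E ->
  (predecessors (relaxed u i s c)).[? w]%fmap =
    if (w == applyControlAction u c i) &&
       (maxe (cost_of s (u, i)) (action_score Pd u c i)%:E < cost_of s w)%E
    then Some (u, i) else (predecessors s).[? w]%fmap.
Proof.
move=> /negP/negbTE pr; rewrite /relaxed pr /=.
set w0 := applyControlAction u c i.
rewrite (fun_if (fun s : state L => (predecessors s).[? w]%fmap)) /= if_same.
case: ifP => nw /=; last by case: eqP => // ->; rewrite nw.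
by rewrite fnd_set; case: eqP => // ->; rewrite nw.
Qed.

Lemma best_relaxed u i s c : ~ (bound s < (action_score Pd u c i)%:E)%E ->
  let s' := relaxed u i s c in
  let w := applyControlAction u c i in
  if ((successor_cost u i s c < bound s)%E && (size Pd <= w.2)%N)
  then bestEnd s' = w /\ bound s' = successor_cost u i s c
  else bestEnd s' = bestEnd s /\ bound s' = bound s.
Proof.
move=> pr /=; set s2 := (if (maxe (cost_of s (u, i)) (action_score Pd u c i)%:E
    < cost_of s (applyControlAction u c i))%E
  then set_cost (insertV s (succ u c) (i + nseg c)) (applyControlAction u c i)
         (u, i) (maxe (cost_of s (u, i)) (action_score Pd u c i)%:E)
  else insertV s (succ u c) (i + nseg c)).
have -> : relaxed u i s c =
    if ((cost_of s2 (applyControlAction u c i) < bound s)%E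
        && (size Pd <= i + nseg c)%N)
    then set_best s2 (applyControlAction u c i)
           (cost_of s2 (applyControlAction u c i)) else s2.
  by rewrite /relaxed; move/negP/negbTE: pr => ->.
have -> : cost_of s2 (applyControlAction u c i) = successor_cost u i s c.
  rewrite /s2 /successor_cost; case: ifP => nw.
    by rewrite cost_of_set_cost eqxx min_r // ltW.
  by rewrite min_l // leNgt nw.
by case: (_ && _) => //=; rewrite /s2; case: (maxe _ _ < _)%E.
Qed.

Lemma successor_late u i c : (i < (applyControlAction u c i).2)%N.
Proof. by have := nseg_gt0 c; rewrite /=; lia. Qed.

Lemma relaxed_evolves u i s c : evolves i s (relaxed u i s c).
Proof.
have [pr|/negP pr] := boolP (bound s < (action_score Pd u c i)%:E)%E.
  by rewrite /relaxed pr.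
have late := successor_late u i c.
have costE w := cost_of_relaxed w pr.
split.
- have := best_relaxed pr; rewrite /=.
  by case: ifP => [/andP[/ltW le_bound _] [_ ->]//|_ [_ ->]].
- move=> k v vk; rewrite tableV_relaxed //; case: ifP => // _.
  by rewrite in_fset1U vk orbT.
- move=> w; rewrite costE; case: eqP => // ->.
  by rewrite /successor_cost ge_min lexx.
- move=> k ki; rewrite tableV_relaxed //; case: eqP => // kE.
  by move: late; rewrite /= -kE; lia.
- by move=> w wi; rewrite costE; case: eqP => // wE; move: wi; rewrite wE; lia.
Qed.

Lemma relaxed_edge_done u i s c : edge_done u i c (relaxed u i s c).
Proof.
have [pr|/negP pr] := boolP (bound s < (action_score Pd u c i)%:E)%E.
  by left; rewrite /relaxed pr.
have late := successor_late u i c.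
have ev := relaxed_evolves u i s c.
right; rewrite (ev_cost_frozen ev (w := (u, i))) //.
have succ_cost : (successor_cost u i s c <=
    maxe (cost_of s (u, i)) (action_score Pd u c i)%:E)%E.
  by rewrite /successor_cost ge_min lexx orbT.
split.
- by rewrite tableV_relaxed // eqxx in_fset1U eqxx.
- by rewrite cost_of_relaxed // eqxx.
- move=> Kw; have := best_relaxed pr; rewrite /= Kw andbT.
  case: ifP => [_ [_ ->]//|/negbT]; rewrite -leNgt => le_succ [_ ->].
  exact: le_trans succ_cost.
Qed.

Lemma relaxed_invariant u i s c : c \in ctl u.2 -> u \in tableV s i ->
  search_invariant s -> search_invariant (relaxed u i s c).
Proof.
move=> cu ui inv_s.
have [pr|/negP pr] := boolP (bound s < (action_score Pd u c i)%:E)%E.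
  by rewrite /relaxed pr.
have late := successor_late u i c.
have ev := relaxed_evolves u i s c.
have costE w := cost_of_relaxed w pr.
(* An edge that is not pruned scores at most the current bound, hence at most the initial one. *)
have dB : (action_score Pd u c i <= B).
  rewrite -lee_fin; apply: le_trans (inv_bound inv_s).
  by rewrite leNgt; exact/negP.
have new_fin : (maxe (cost_of s (u, i)) (action_score Pd u c i)%:E < +oo)%E.
  by rewrite gt_max (inv_table inv_s ui) ltry.
have new_ge0 : (0 <= maxe (cost_of s (u, i)) (action_score Pd u c i)%:E)%E.
  by rewrite le_max (inv_cost_ge0 inv_s).
(* The target lies in a positive layer, so an update of [bestEnd] never restores its initial
   value. *)
have w_neq : applyControlAction u c i <> (O, 0%N).
  by move=> wE; move: late; rewrite wE.
split.
- exact: le_trans (ev_bound ev) (inv_bound inv_s).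
- have := best_relaxed pr; rewrite /=.
  by case: ifP => [_ [-> _] //|_ [-> ->]]; exact: (inv_start inv_s).
- have := best_relaxed pr; rewrite /=.
  case: ifP => [/andP[_ Kw] [-> ->] _|_ [-> ->]].
    by rewrite costE eqxx.
  by case/(inv_best inv_s) => ? ?; split=> //; exact: le_trans (ev_cost ev _) _.
- move=> w; rewrite costE; case: eqP => _; last exact: (inv_cost_ge0 inv_s).
  by rewrite /successor_cost le_min new_ge0 (inv_cost_ge0 inv_s).
- move=> w p; rewrite predecessors_relaxed // (costE w).
  case: eqP => [->|_] /=; last first.
    move=> /(inv_pred inv_s)[c' ? le_c']; exists c' => //.
    by apply: le_trans le_c'; rewrite le_max2 ?(ev_cost ev).
  rewrite /successor_cost; case: ltP => [lt_new|le_old].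
    move=> [<-]; exists c => //=.
    by rewrite (ev_cost_frozen ev (w := (u, i))).
  move=> /(inv_pred inv_s)[c' ? le_c']; exists c' => //.
  by apply: le_trans le_c'; rewrite le_max2 ?(ev_cost ev).
- move=> w; rewrite costE predecessors_relaxed //.
  case: eqP => [->|_] /=; last exact: (inv_reached inv_s).
  rewrite /successor_cost; case: (ltP (maxe _ _) (cost_of s _)) => [_ _|_].
    by right; exists (u, i).
  exact: (inv_reached inv_s).
- move=> v k; rewrite tableV_relaxed // costE.
  have [[-> ->] _|vk] := eqVneq (v, k) (applyControlAction u c i).
    by rewrite /successor_cost gt_min new_fin orbT.
  case: eqP => [kE|_]; last exact: (inv_table inv_s).
  rewrite in_fset1U => /predU1P[vE|]; last exact: (inv_table inv_s).
  by move: vk; rewrite vE kE eqxx.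
- move=> v k; rewrite tableV_relaxed //.
  case: eqP => [->|_]; last exact: (inv_near inv_s).
  rewrite in_fset1U => /predU1P[->|]; last exact: (inv_near inv_s).
  (* The target is the last sample of [c], so its distance to [P_d] is one of those whose maximum is
     the action score. *)
  move=> jK; rewrite -placed_last; apply: le_trans dB.
  by rewrite -{2}(addKn i (nseg c)) le_action_score // leq_addr leqnn.
- exact: (ev_table ev (inv_origin inv_s)).
- exact: le_trans (ev_cost ev _) (inv_origin_cost inv_s).
Qed.

(** * The loops over actions, vertices and layers *)

Lemma scan_vertexP i u s : u \in tableV s i -> search_invariant s ->
  [/\ search_invariant (scan_vertex Pd ord i s u).2,
      evolves i s (scan_vertex Pd ord i s u).2,
      {in ctl u.2, forall c, edge_done u i c (scan_vertex Pd ord i s u).2}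
    & ((scan_vertex Pd ord i s u).1 <=
       1 + #|ctl u.2| * (3 * max_points L + 16))%N].
Proof.
move=> ui inv_s; have scanE := scanCP ord s (u, i).
(* Carrying [evolves i s s1] along keeps [u] in layer [i] of the current table. *)
pose I s1 := search_invariant s1 /\ evolves i s s1.
have relax_spec s1 c : c \in scanC ord s (u, i) -> I s1 ->
    [/\ I (relax Pd i u s1 c).2, evolves i s1 (relax Pd i u s1 c).2,
        edge_done u i c (relax Pd i u s1 c).2
      & ((relax Pd i u s1 c).1 <= 3 * max_points L + 15)%N].
  move=> cu [inv1 ev1]; have [-> time_c] := relaxE u i s1 c.
  have c_ctl : c \in ctl u.2 by rewrite (perm_mem scanE) mem_enum in cu.
  have ev_c := relaxed_evolves u i s1 c.
  split=> //; first split.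
  - by apply: relaxed_invariant => //; rewrite (ev_table_frozen ev1).
  - exact: evolves_trans ev1 ev_c.
  - exact: relaxed_edge_done.
  - apply: leq_trans time_c _; rewrite leq_add2r leq_mul2l /=.
    exact: (leq_bigmax c).
have [[inv' ev'] _ done' time'] := tfold_spec (T := fun=> _) (@evolves_refl i)
  (@evolves_trans i) (@edge_done_evolves u i) relax_spec
  (conj inv_s (evolves_refl i s)).
split=> // [c cu|]; first by apply: done'; rewrite (perm_mem scanE) mem_enum.
apply: leq_trans time' _; rewrite big_const_seq count_predT iter_addn_0.
by rewrite (perm_size scanE) -cardE addnC [leqRHS]addnC mulnC addnCA.
Qed.

Definition layer_done i s : Prop :=
  forall u, u \in tableV s i -> {in ctl u.2, forall c, edge_done u i c s}.

Lemma scan_layerP i s : search_invariant s ->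
  [/\ search_invariant (scan_layer Pd ord s i).2,
      evolves i s (scan_layer Pd ord s i).2,
      layer_done i (scan_layer Pd ord s i).2
    & ((scan_layer Pd ord s i).1 <= 1 +
       (\sum_(u <- tableV s i) #|ctl u.2|) * (3 * max_points L + 18))%N].
Proof.
move=> inv_s; have scanE := scanVP ord s i.
pose I s1 := search_invariant s1 /\ evolves i s s1.
pose D u s1 := {in ctl u.2, forall c, edge_done u i c s1}.
pose T u := (1 + #|ctl u.2| * (3 * max_points L + 16))%N.
have scan_spec s1 u : u \in scanV ord s i -> I s1 ->
    [/\ I (scan_vertex Pd ord i s1 u).2,
        evolves i s1 (scan_vertex Pd ord i s1 u).2,
        D u (scan_vertex Pd ord i s1 u).2
      & ((scan_vertex Pd ord i s1 u).1 <= T u)%N].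
  move=> ui [inv1 ev1].
  have [|//|inv2 ev2 D2 T2] := @scan_vertexP i u s1.
    by rewrite (ev_table_frozen ev1) //; rewrite (perm_mem scanE) in ui.
  by split=> //; split=> //; exact: evolves_trans ev1 ev2.
have Dmono u s1 s2 : D u s1 -> evolves i s1 s2 -> D u s2.
  by move=> D1 ev c cu; exact: edge_done_evolves (D1 c cu) ev.
have [[inv' ev'] _ done' time'] := tfold_spec (@evolves_refl i)
  (@evolves_trans i) Dmono scan_spec (conj inv_s (evolves_refl i s)).
split=> // [u ui|].
  (* The list of vertices is fixed when the loop starts; as layer [i] is frozen, it is still the
     whole layer at the end. *)
  apply: done'; rewrite (perm_mem scanE).
  by rewrite -(ev_table_frozen ev' (leqnn i)).
apply: leq_trans time' _; rewrite leq_add2l (perm_big _ scanE) big_distrl /=.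
apply: leq_sum => u _; rewrite /T.
(* Every vertex has at least one action, so its two steps of loop overhead are charged to its
   actions: 18 is 16 + 2. *)
have : (0 < #|ctl u.2|)%N by rewrite card_gt0 ctl_neq0.
by move: (#|_|) (max_points L) => m n; nia.
Qed.

(** [W] must bound the edges out of a layer in every state satisfying the invariant, since a layer
    keeps growing until the search reaches it. *)
Lemma scan_layersP (W n m : nat) s :
  (forall s1 i, search_invariant s1 -> (i < m + n)%N ->
     (\sum_(u <- tableV s1 i) #|ctl u.2| <= W)%N) ->
  search_invariant s -> (forall i, (i < m)%N -> layer_done i s) ->
  let r := tfold (scan_layer Pd ord) s (iota m n) in
  [/\ search_invariant r.2, forall i, (i < m + n)%N -> layer_done i r.2
    & (r.1 <= 1 + n * (2 + W * (3 * max_points L + 18)))%N].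
Proof.
elim: n m s => [|n IHn] m s leW inv_s done_s.
  by split=> // i; rewrite addn0; exact: done_s.
have [inv1 ev1 done1 time1] := scan_layerP m inv_s.
have leW' s1 i : search_invariant s1 -> (i < m.+1 + n)%N ->
    (\sum_(u <- tableV s1 i) #|ctl u.2| <= W)%N.
  by move=> inv_s1; rewrite addSnnS; exact: leW.
have done_m i : (i < m.+1)%N -> layer_done i (scan_layer Pd ord s m).2.
  rewrite ltnS leq_eqVlt => /predU1P[->//|im].
  move=> u; rewrite (ev_table_frozen ev1 (ltnW im)) => ui c cu.
  exact: edge_done_evolves (done_s i im u ui c cu) (evolvesW (ltnW im) ev1).
have [inv' done' time'] := IHn m.+1 (scan_layer Pd ord s m).2 leW' inv1 done_m.
rewrite addSnnS in done'; split=> //=.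
have := leW s m inv_s; rewrite -addSnnS leq_addr => /(_ isT) leWs.
have := leq_mul leWs (leqnn (3 * max_points L + 18)); lia.
Qed.

(** * Optimality of the path read off the final state *)

Hypothesis Pd_start : nth 0 Pd 0 = pos O.

Lemma traced_cost s w cs : search_invariant s ->
  traced Pd O (predecessors s) w cs ->
  [/\ lattice_path O cs, endpoint O cs = w.1, path_nseg cs = w.2
    & forall k, (k <= w.2)%N -> (k < size Pd)%N ->
        ((edist (nth 0 Pd k) (path_point O cs k))%:E <= cost_of s w)%E].
Proof.
move=> inv_s.
elim=> [|{}w p {}cs c pred_w _ [IHpath IHend IHnseg IHcost] cp wE cmin].
  split=> //= [|k]; first by rewrite /path_nseg big_nil.
  by rewrite leqn0 => /eqP-> _; rewrite Pd_start edist_refl inv_cost_ge0.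
(* The invariant controls the score of some action [c'] from [p] to [w]; the traced action [c]
   scores no more, being least among the parallel ones. *)
have [c' [c'p c'w] le_w] := inv_pred inv_s pred_w.
have le_pw : (cost_of s p <= cost_of s w)%E.
  by apply: le_trans le_w; rewrite le_max lexx.
have le_dw : ((action_score Pd p.1 c p.2)%:E <= cost_of s w)%E.
  by apply: le_trans le_w; rewrite le_max lee_fin cmin ?orbT.
have w2E : w.2 = (path_nseg cs + nseg c)%N by rewrite -wE IHnseg.
split.
- by rewrite lattice_path_rcons IHpath IHend.
- by rewrite /endpoint foldl_rcons -/(endpoint O cs) IHend -wE.
- by rewrite path_nseg_rcons.
- move=> k kw kK; rewrite path_point_rcons -?w2E // IHnseg IHend.
  case: leqP => [kp|pk]; first exact: le_trans (IHcost _ kp kK) le_pw.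
  apply: le_trans le_dw; rewrite lee_fin le_action_score // ltnW //=.
  by rewrite -IHnseg -w2E.
Qed.

(** A predecessor has finite cost too and lies in a strictly earlier layer, so going back
    terminates, and it can stop only at the origin. *)
Lemma traced_exists s w : search_invariant s -> (cost_of s w < +oo)%E ->
  exists cs, traced Pd O (predecessors s) w cs.
Proof.
move=> inv_s; have [n] := ubnP w.2; elim: n w => // n IHn w wn cost_w.
have [->|[p pred_w]] := inv_reached inv_s cost_w.
  by exists [::]; exact: TracedOrigin.
have [c [cp cw] le_w] := inv_pred inv_s pred_w.
have pw : (p.2 < w.2)%N by rewrite -cw successor_late.
have [||cs tr] := IHn p; first exact: leq_trans pw _.
  by apply: le_lt_trans cost_w; apply: le_trans le_w; rewrite le_max lexx.
pose parallel c' := (c' \in ctl p.1.2) && (applyControlAction p.1 c' p.2 == w).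
have par_c : parallel c by rewrite /parallel cp cw eqxx.
case: (arg_minP (fun c' => action_score Pd p.1 c' p.2) par_c) => c0.
move=> /andP[c0p /eqP c0w] c0min; exists (rcons cs c0).
apply: (TracedStep pred_w tr c0p c0w) => c' c'p c'w.
by apply: c0min; rewrite /parallel c'p c'w eqxx.
Qed.

(** Follow the path while its vertices are in the table at cost at most [x]. The first edge that is
    pruned, or that reaches index [size Pd] or beyond, forces the bound to be at most [x]; the
    length of the path ensures that such an edge occurs. *)
Lemma bound_le_path s (x : R) u i cs :
  (forall k, (k < size Pd)%N -> layer_done k s) -> 0 <= x ->
  (i < size Pd)%N -> u \in tableV s i -> (cost_of s (u, i) <= x%:E)%E ->
  lattice_path u cs -> (size Pd <= i + path_nseg cs)%N ->
  (forall k, (i <= k < size Pd)%N ->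
     edist (nth 0 Pd k) (path_point u cs (k - i)) <= x) ->
  (bound s <= x%:E)%E.
Proof.
move=> done_s x0; elim: cs u i => [|c cs IHcs] u i iK ui cost_ui /=.
  by rewrite /path_nseg big_nil; lia.
move=> /andP[cu path_cs]; rewrite path_nseg_cons addnA => Kcs le_x.
have dx : action_score Pd u c i <= x.
  apply: action_score_le => // k /andP[ik kj] kK.
  by have := le_x k; rewrite ik kK leq_subLR kj; exact.
have max_x : (maxe (cost_of s (u, i)) (action_score Pd u c i)%:E <= x%:E)%E.
  by rewrite ge_max cost_ui lee_fin.
have [lt_bound|[vj cost_v bound_v]] := done_s i iK u ui c cu.
  by apply: ltW (lt_le_trans lt_bound _); rewrite lee_fin.
have [Kj|jK] := leqP (size Pd) (i + nseg c).
  exact: le_trans (bound_v Kj) max_x.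
apply: (IHcs (succ u c) (i + nseg c)%N) => // [|k /andP[jk kK]].
  exact: le_trans cost_v max_x.
rewrite -path_point_cons.
have -> : (nseg c + (k - (i + nseg c)) = k - i)%N by lia.
by apply: le_x; lia.
Qed.

Hypothesis Pd_neq0 : (0 < size Pd)%N.

Lemma bound_le_score s cs : search_invariant s ->
  (forall k, (k < size Pd)%N -> layer_done k s) ->
  lattice_path O cs -> long_enough Pd cs ->
  (bound s <= (path_score Pd O cs)%:E)%E.
Proof.
move=> inv_s done_s path_cs long_cs.
(* A path that stops exactly at the end of [Pd] is never compared with the
   bound; one more action makes it long enough and costs nothing. *)
have /set0Pn[c c_in] := ctl_neq0 (endpoint O cs).2.
apply: (bound_le_path (u := O) (i := 0) (cs := rcons cs c) done_s) => //.
- exact: path_score_ge0.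
- exact: inv_origin.
- by apply: le_trans (inv_origin_cost inv_s) _; rewrite lee_fin path_score_ge0.
- by rewrite lattice_path_rcons path_cs.
- move: long_cs; rewrite /long_enough path_nseg_rcons.
  by have := nseg_gt0 c; lia.
- move=> k kK; rewrite subn0 path_point_rcons; last first.
    by move: long_cs kK; rewrite /long_enough; lia.
  case: leqP => [_|]; first by apply: le_path_score.
  by move: long_cs kK; rewrite /long_enough; lia.
Qed.

(** The final bound is at most every competing score. If [bestEnd] never moved, that bound is still
    the score of [gs]; otherwise it is at least the cost of [bestEnd], hence at least the score of
    the traced path. *)
Lemma found_path_optimal s gs : greedy_path Pd O gs -> B = path_score Pd O gs ->
  search_invariant s -> (forall k, (k < size Pd)%N -> layer_done k s) ->
  let out := (bestEnd s, predecessors s) in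
  (exists cs, found_path Pd O gs out cs) /\
  (forall cs, found_path Pd O gs out cs -> optimal_path Pd O cs).
Proof.
move=> /greedy_from_path[path_gs long_gs] BE inv_s done_s out.
rewrite /found_path /=; case: eqP => [startE|best_neq]; split.
- by exists gs.
- move=> _ ->; split=> // cs path_cs long_cs.
  by rewrite -lee_fin -BE -(inv_start inv_s startE) bound_le_score.
- apply: traced_exists => //; have [_ le_bound] := inv_best inv_s best_neq.
  apply: le_lt_trans le_bound (le_lt_trans (inv_bound inv_s) _).
  exact: ltry.
- move=> cs /(traced_cost inv_s)[path_cs _ nsegE le_cost].
  have [Kbest cost_best] := inv_best inv_s best_neq.
  split=> // [|cs' path_cs' long_cs'].
    by rewrite /long_enough nsegE; lia.
  apply: bigmax_le => [|k _]; first exact: path_score_ge0.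
  rewrite -lee_fin.
  apply: le_trans (bound_le_score inv_s done_s path_cs' long_cs').
  apply: le_trans cost_best; apply: le_cost => //.
  by apply: ltnW; exact: leq_trans Kbest.
Qed.

Hypothesis B_ge0 : 0 <= B.

Lemma invariant_init : search_invariant (init O B).
Proof.
have costE w : cost_of (init O B) w = if w == (O, 0%N) then 0%E else +oo%E.
  by rewrite /cost_of /= fnd_set fnd_fmap0; case: eqP.
split=> //=.
- by move=> w; rewrite costE; case: ifP.
- by move=> w p; rewrite fnd_fmap0.
- by move=> w; rewrite costE; case: eqP => // ->; left.
- move=> u k; case: eqP => [->|//]; rewrite in_fset1 => /eqP->.
  by rewrite costE eqxx ltry.
- move=> u k; case: eqP => [->|//]; rewrite in_fset1 => /eqP-> _.
  by rewrite Pd_start edist_refl.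
- by rewrite in_fset1.
- by rewrite costE eqxx.
Qed.

End Search.

(** * Counting the lattice points near a path point, and the step count *)

(** For [r > 0], a closed interval of length [2 * b] contains at most this many multiples of [r]. *)
Definition multiples_bound {R : realType} (r b : R) : nat :=
  (Num.truncn (2 * b / r)).+1.

Lemma multiples_near (R : realType) (r p b : R) : 0 < r ->
  exists2 X : seq int, size X = multiples_bound r b
    & forall a : int, `|p - r * a%:~R| <= b -> a \in X.
Proof.
move=> r0; pose m := Num.ceil ((p - b) / r).
(* Consecutive integers from [m], the least one whose multiple of [r] is not below [p - b]. *)
exists [seq m + k%:Z | k <- iota 0 (multiples_bound r b)].
  by rewrite size_map size_iota.
move=> a; rewrite ler_distlC => /andP[lo hi].
have am : m <= a by rewrite ceil_le_int ler_pdivrMr // mulrC; lra.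
have le_span : (`|a - m| <= Num.truncn (2 * b / r))%N.
  rewrite truncn_ge_nat; last first.
    by apply: divr_ge0; [lra|exact: ltW].
  rewrite natr_absz ger0_norm ?subr_ge0 // intrB ler_pdivlMr //.
  have := ceil_ge ((p - b) / r); rewrite -/m ler_pdivrMr //; nra.
apply/mapP; exists `|a - m|%N; first by rewrite mem_iota add0n ltnS.
by rewrite gez0_abs ?subr_ge0 // [RHS]addrC subrK.
Qed.

Section Runtime.
Context {R : realType} {L : lattice_planner R}.
Variables (Pd : seq (R * R)) (ord : scan_order L) (O : lpoint L) (B : R).

Definition branching : nat :=
  (multiples_bound (resx L) B * multiples_bound (resy L) B * #|action L|)%N.

Lemma invariant_branching s k : search_invariant Pd O B s -> (k < size Pd)%N ->
  (\sum_(u <- tableV s k) #|ctl u.2| <= branching)%N.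
Proof.
move=> inv_s kK; rewrite (partition_big (fun u : lpoint L => u.2) predT) //=.
rewrite /branching -(ctl_card L) big_distrr /=; apply: leq_sum => t _.
rewrite (eq_bigr (fun=> #|ctl t|)); last by move=> u /eqP->.
rewrite big_const_seq iter_addn_0 [leqRHS]mulnC leq_mul2l; apply/orP; right.
have [X <- Xnear] := multiples_near (nth 0 Pd k).1 B (resx_gt0 L).
have [Y <- Ynear] := multiples_near (nth 0 Pd k).2 B (resy_gt0 L).
rewrite -(size_allpairs pair) -size_filter.
(* Vertices of the same heading are told apart by their integer coordinates, and these lie in [X]
   and [Y] because a coordinate difference never exceeds the distance. *)
rewrite -(size_map (fun u : lpoint L => u.1)); apply: uniq_leq_size.
  rewrite map_inj_in_uniq ?filter_uniq ?fset_uniq //.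
  move=> [z t1] [z' t2]; rewrite !mem_filter /=.
  by move=> /andP[/eqP-> _] /andP[/eqP-> _] ->.
move=> z /mapP[u]; rewrite mem_filter => /andP[_ uk] ->.
have near := inv_near inv_s uk kK; case: u near {uk} => [[a b] t'] /= near.
apply: allpairs_f.
- exact/Xnear/(le_trans (edist_ge1 _ (pos (a, b, t')))).
- exact/Ynear/(le_trans (edist_ge2 _ (pos (a, b, t')))).
Qed.

Lemma closestPath_spec gs : (0 < size Pd)%N -> nth 0 Pd 0 = pos O ->
  greedy_path Pd O gs -> B = path_score Pd O gs ->
  let out := (closestPath Pd ord O B).2 in
  [/\ exists cs, found_path Pd O gs out cs,
      forall cs, found_path Pd O gs out cs -> optimal_path Pd O cs
    & ((closestPath Pd ord O B).1 <= size Pd + 6 +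
         size Pd * (2 + branching * (3 * max_points L + 18)))%N].
Proof.
move=> Pd0 Pd_start greedy BE.
have B0 : 0 <= B by rewrite BE path_score_ge0.
have [inv_s done_s time_s] := scan_layersP ord (m := 0) (n := size Pd)
  invariant_branching (invariant_init Pd_start B0) (fun i : nat => ltac:(done)).
have [ex opt] := found_path_optimal Pd_start Pd0 greedy BE inv_s done_s.
by split=> //; rewrite /closestPath /tbind /=; lia.
Qed.

End Runtime.

(** * The asymptotic form of the runtime *)

(** The additional 1 in [multiples_bound] is at most [eps^-1 * (b / r)], by [eps * r <= b]. *)
Lemma multiples_bound_le (R : realType) (eps r b : R) : 0 < eps -> 0 < r ->
  eps * r <= b -> (multiples_bound r b)%:R <= (2 + eps^-1) * (b / r).
Proof.
move=> eps0 r0 epsb; have b0 : 0 <= b by nra.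
have : (Num.truncn (2 * b / r))%:R <= 2 * b / r.
  by rewrite truncn_le // divr_ge0 ?mulr_ge0 // ltW.
have : 1 <= eps^-1 * (b / r).
  by rewrite mulrC -!mulrA -invfM ler_pdivlMr ?mul1r ?mulr_gt0 // mulrC.
rewrite /multiples_bound -natr1; lra.
Qed.

Theorem theorem1 (R : realType) :
  (forall (L : lattice_planner R) (Pd : seq (R * R)) (O : lpoint L)
      (ord : scan_order L) (gs : seq (action L)) (B : R),
    (0 < size Pd)%N -> nth 0 Pd 0 = pos O ->
    greedy_path Pd O gs -> B = path_score Pd O gs ->
    let out := (closestPath Pd ord O B).2 in
    (exists cs, found_path Pd O gs out cs) /\
    (forall cs, found_path Pd O gs out cs -> optimal_path Pd O cs)) /\
  (forall eps : R, 0 < eps -> exists kappa : R,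
    forall (L : lattice_planner R) (Pd : seq (R * R)) (O : lpoint L)
      (ord : scan_order L) (gs : seq (action L)) (B : R),
    (0 < size Pd)%N -> nth 0 Pd 0 = pos O ->
    greedy_path Pd O gs -> B = path_score Pd O gs ->
    eps * resx L <= B -> eps * resy L <= B ->
    (closestPath Pd ord O B).1%:R <=
      kappa * ((max_points L)%:R * (B ^+ 2 / (resx L * resy L)) *
               (size Pd)%:R * #|action L|%:R)).
Proof.
split=> [L Pd O ord gs B Pd0 Pd_start greedy BE | eps eps0].
  by have [] := closestPath_spec ord Pd0 Pd_start greedy BE.
(* The first summand pays for the part of the time linear in [K] alone, using
   [eps ^+ 2 <= B ^+ 2 / A]; the second pays for the edges scanned, with one factor [2 + eps^-1] per
   coordinate. *)
exists (9 / eps ^+ 2 + 12 * (2 + eps^-1) ^+ 2).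
move=> L Pd O ord gs B Pd0 Pd_start greedy BE epsx epsy.
have [_ _ time] := closestPath_spec ord Pd0 Pd_start greedy BE.
have /set0Pn[c _] := ctl_neq0 O.2.
have N2 : (2 <= max_points L)%N.
  by apply: leq_trans (samples_gt1 c) _; exact: (leq_bigmax c).
have C1 : (1 <= #|action L|)%N by apply/card_gt0P; exists c.
have rx0 := resx_gt0 L; have ry0 := resy_gt0 L.
set N := max_points L in time N2 *; set C := #|action L| in C1 *.
set K := size Pd in time Pd0 *; set W := @branching R L B in time.
set x := B ^+ 2 / (resx L * resy L).
have xE : x = (B / resx L) * (B / resy L) by rewrite /x invfM; ring.
have le_x : eps ^+ 2 <= x.
  rewrite xE expr2; apply: ler_pM; rewrite ?(ltW eps0) //.
  - by rewrite ler_pdivlMr.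
  - by rewrite ler_pdivlMr.
have le_W : W%:R <= (2 + eps^-1) ^+ 2 * x * C%:R.
  rewrite /W /branching !natrM ler_wpM2r ?ler0n // xE.
  have -> (y z t : R) : y ^+ 2 * (z * t) = (y * z) * (y * t) by ring.
  by apply: ler_pM; rewrite ?ler0n // multiples_bound_le.
(* From [1 <= K], [3 * K + 6 <= 9 * K]; from [2 <= N], [3 * N + 18 <= 12 * N]. *)
have timeN : ((closestPath Pd ord O B).1 <= 9 * K + 12 * (K * W * N))%N.
  apply: leq_trans time _.
  have : (K * W * 18 <= K * W * (9 * N))%N by rewrite leq_mul2l; lia.
  by nia.
have NC1 : 1 <= N%:R * C%:R :> R by rewrite -natrM ler1n muln_gt0; lia.
have K0 : 0 <= K%:R :> R by rewrite ler0n.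
have N0 : 0 <= N%:R :> R by rewrite ler0n.
apply: (@le_trans _ _ (9 * K%:R + 12 * (K%:R * W%:R * N%:R))).
  by rewrite -!natrM -natrD ler_nat.
rewrite [leRHS]mulrDl; apply: lerD.
- have -> : 9 / eps ^+ 2 * (N%:R * x * K%:R * C%:R) =
      9 * K%:R * ((N%:R * C%:R) * (x / eps ^+ 2)) by ring.
  rewrite ler_peMr ?mulr_ge0 //.
  have : 1 <= x / eps ^+ 2 by rewrite ler_pdivlMr ?exprn_gt0 // mul1r.
  by nra.
- have -> : 12 * (2 + eps^-1) ^+ 2 * (N%:R * x * K%:R * C%:R) =
      12 * (K%:R * ((2 + eps^-1) ^+ 2 * x * C%:R) * N%:R) by ring.
  by rewrite ler_pM2l // ler_wpM2r // ler_wpM2l.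
Qed.
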